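(* Consider the 1D first-order Lax–Friedrichs scheme $$\bar{\mathbf U}_j^{n+1}=\bar{\mathbf U}_j^n-\frac{\Delta t_n}{\Delta x}\Big(\hat{\mathbf F}_1(\bar{\mathbf U}_j^n,\bar{\mathbf U}_{j+1}^n)-\hat{\mathbf F}_1(\bar{\mathbf U}_{j-1}^n,\bar{\mathbf U}_j^n)\Big).$$ Assume that $\bar{\mathbf U}_j^0\in\mathcal G$ and $\bar B_{1,j}^0=B_{const}$ for all $j$ (with $B_{const}$ independent of $j$), and that at each time level $n$ the parameter $\alpha_{1,n}^{LF}$ satisfies $$\alpha_{1,n}^{LF}>\max_j\alpha_1(\bar{\mathbf U}_{j+1}^n,\bar{\mathbf U}_{j-1}^n).$$ Then the state $\bar{\mathbf U}_j^n$, computed by the scheme under the CFL condition $$0<\alpha_{1,n}^{LF}\,\Delta t_n/\Delta x\le1,$$ belongs to $\mathcal G$ and satisfies $\bar B_{1,j}^n=B_{const}$ for all $j$ and all $n\in\mathbb N$.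
   Context: A state is $\mathbf U=(\rho,\mathbf m,\mathbf B,E)^\top\in\mathbb R^8$ with $\rho,E\in\mathbb R$, $\mathbf m,\mathbf B\in\mathbb R^3$. For $\rho>0$ put $\mathbf v=\mathbf m/\rho$, $\mathcal E(\mathbf U)=E-\frac12\big(\frac{|\mathbf m|^2}{\rho}+|\mathbf B|^2\big)$, $e=\mathcal E(\mathbf U)/\rho$, $p=p(\rho,e)$, $p_{tot}=p+\frac{|\mathbf B|^2}{2}$. The equation of state $p(\rho,e)$ is any function such that, whenever $\rho>0$, one has $e>0\Leftrightarrow p(\rho,e)>0$. Admissible states: $\mathcal G=\{\mathbf U:\rho>0,\ \mathcal E(\mathbf U)>0\}$. Flux: $$\mathbf F_i(\mathbf U)=\big(\rho v_i,\ \rho v_i\mathbf v-B_i\mathbf B+p_{tot}\mathbf e_i,\ v_i\mathbf B-B_i\mathbf v,\ v_i(E+p_{tot})-B_i(\mathbf v\cdot\mathbf B)\big)^\top,$$ with $\mathbf e_i$ the $i$-th standard unit vector of $\mathbb R^3$. LF flux: $\hat{\mathbf F}_1(\mathbf U^-,\mathbf U^+)=\frac12\big(\mathbf F_1(\mathbf U^-)+\mathbf F_1(\mathbf U^+)-\alpha_{1,n}^{LF}(\mathbf U^+-\mathbf U^-)\big)$. For $\mathbf U,\tilde{\mathbf U}\in\mathcal G$, $\alpha_i(\mathbf U,\tilde{\mathbf U})=\min_{\sigma\in\mathbb R}\alpha_i(\mathbf U,\tilde{\mathbf U};\sigma)$ with $$\alpha_i(\mathbf U,\tilde{\mathbf U};\sigma)=\max\big\{|v_i|+\mathscr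 C_i,\ |\tilde v_i|+\tilde{\mathscr C}_i,\ |\sigma v_i+(1-\sigma)\tilde v_i|+\max\{\mathscr C_i,\tilde{\mathscr C}_i\}\big\}+\frac{|\tilde{\mathbf B}-\mathbf B|}{\sqrt2}\sqrt{\frac{\sigma^2}{\rho}+\frac{(1-\sigma)^2}{\tilde\rho}},$$ $$\mathscr C_i=\frac1{\sqrt2}\Big[\mathscr C_s^2+\frac{|\mathbf B|^2}{\rho}+\sqrt{\Big(\mathscr C_s^2+\frac{|\mathbf B|^2}{\rho}\Big)^2-4\frac{\mathscr C_s^2B_i^2}{\rho}}\Big]^{1/2},\qquad \mathscr C_s=\frac{p}{\rho\sqrt{2e}},$$ and $\tilde{\mathscr C}_i$ the same quantity for $\tilde{\mathbf U}$. The mesh is uniform with spacing $\Delta x>0$ and cell index $j\in\mathbb Z$ (maxima over $j$ understood as suprema); $\bar B_{1,j}^n$ is the first magnetic component of $\bar{\mathbf U}_j^n$; $\Delta t_n$ is the step from time level $n$ to $n+1$. *)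

(* Defs.v *)
From HB Require Import structures.
From mathcomp Require Import all_boot all_order all_algebra.
From mathcomp Require Import all_classical all_reals all_analysis.

Set Implicit Arguments.
Unset Strict Implicit.
Unset Printing Implicit Defensive.

Import Order.TTheory GRing.Theory Num.Theory.

Local Open Scope classical_set_scope.
Local Open Scope ring_scope.

(* The state space R^8, in blocks (rho, m, B, E).  The copies R^o (convertible
   to R) are needed for the product to inherit a vector space structure. *)
Definition state (R : realType) : lmodType R :=
  (R^o * 'rV[R]_3 * 'rV[R]_3 * R^o)%type.

Definition mkstate (R : realType) (rho : R) (m B : 'rV[R]_3) (E : R) : state R :=
  (rho, m, B, E).

Definition density (R : realType) (U : state R) : R := U.1.1.1.
Definition momentum (R : realType) (U : state R) : 'rV[R]_3 := U.1.1.2.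
Definition magnetic (R : realType) (U : state R) : 'rV[R]_3 := U.1.2.
Definition energy (R : realType) (U : state R) : R := U.2.

(* Euclidean structure of R^3; the library norm `|_| on matrices is the
   sup norm. *)
Definition dot (R : realType) (u v : 'rV[R]_3) : R :=
  \sum_(i < 3) u ord0 i * v ord0 i.
Definition enorm (R : realType) (u : 'rV[R]_3) : R := Num.sqrt (dot u u).

Definition velocity (R : realType) (U : state R) : 'rV[R]_3 :=
  (density U)^-1 *: momentum U.

(* \mathcal E(U), as opposed to the specific internal energy e. *)
Definition internal_energy (R : realType) (U : state R) : R :=
  energy U - 2^-1 * (enorm (momentum U) ^+ 2 / density U
                     + enorm (magnetic U) ^+ 2).

Definition specific_energy (R : realType) (U : state R) : R :=
  internal_energy U / density U.

Definition admissible (R : realType) : set (state R) :=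
  [set U | 0 < density U /\ 0 < internal_energy U].

Definition is_eos (R : realType) (p : R -> R -> R) : Prop :=
  forall rho e : R, 0 < rho -> (0 < e <-> 0 < p rho e).

Definition pressure (R : realType) (p : R -> R -> R) (U : state R) : R :=
  p (density U) (specific_energy U).

Definition total_pressure (R : realType) (p : R -> R -> R) (U : state R) : R :=
  pressure p U + enorm (magnetic U) ^+ 2 / 2.

(* Space directions 1, 2, 3 are the indices 0, 1, 2 of 'I_3. *)
Definition flux (R : realType) (p : R -> R -> R) (i : 'I_3) (U : state R) :
    state R :=
  let v := velocity U in
  let B := magnetic U in
  let vi := v ord0 i in
  let Bi := B ord0 i in
  mkstate
    (density U * vi)
    ((density U * vi) *: v - Bi *: B + total_pressure p U *: delta_mx ord0 i)
    (vi *: B - Bi *: v)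
    (vi * (energy U + total_pressure p U) - Bi * dot v B).

Definition LF_flux (R : realType) (p : R -> R -> R) (a : R)
    (Um Up : state R) : state R :=
  2^-1 *: (flux p ord0 Um + flux p ord0 Up - a *: (Up - Um)).

Definition C_s (R : realType) (p : R -> R -> R) (U : state R) : R :=
  pressure p U / (density U * Num.sqrt (2 * specific_energy U)).

Definition C_ (R : realType) (p : R -> R -> R) (i : 'I_3) (U : state R) : R :=
  let q := C_s p U ^+ 2 + enorm (magnetic U) ^+ 2 / density U in
  (Num.sqrt 2)^-1 *
  Num.sqrt (q + Num.sqrt
    (q ^+ 2 - 4 * (C_s p U ^+ 2 * magnetic U ord0 i ^+ 2 / density U))).

Definition alpha_at (R : realType) (p : R -> R -> R) (i : 'I_3)
    (U U' : state R) (s : R) : R :=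
  let vi := velocity U ord0 i in
  let vi' := velocity U' ord0 i in
  Num.max (`|vi| + C_ p i U)
    (Num.max (`|vi'| + C_ p i U')
      (`|s * vi + (1 - s) * vi'| + Num.max (C_ p i U) (C_ p i U')))
  + enorm (magnetic U' - magnetic U) / Num.sqrt 2
    * Num.sqrt (s ^+ 2 / density U + (1 - s) ^+ 2 / density U').

(* The minimum over s is attained for admissible states (alpha_at is then
   continuous in s, and either coercive or constant), so inf is that minimum. *)
Definition alpha (R : realType) (p : R -> R -> R) (i : 'I_3)
    (U U' : state R) : R :=
  inf (range (alpha_at p i U U')).

Definition LF_scheme (R : realType) (p : R -> R -> R) (dx : R)
    (dt a : nat -> R) (U : nat -> int -> state R) : Prop :=
  forall (n : nat) (j : int),
    U n.+1 j = U n j - (dt n / dx) *: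
      (LF_flux p (a n) (U n j) (U n (j + 1))
       - LF_flux p (a n) (U n (j - 1)) (U n j)).

(* Main.v *)
Require Import Defs.
From HB Require Import structures.
From mathcomp Require Import all_boot all_order all_algebra.
From mathcomp Require Import all_classical all_reals all_analysis.
From mathcomp Require Import ring lra.

Set Implicit Arguments.
Unset Strict Implicit.
Unset Printing Implicit Defensive.

Import Order.TTheory GRing.Theory Num.Theory.

Local Open Scope classical_set_scope.
Local Open Scope ring_scope.

(** The admissible states form the convex set cut out by linear inequalities:
    the kinetic plus magnetic energy |m|^2/(2 rho) + |B|^2/2 is convex, so it
    is the supremum of its tangent planes, and the total energy exceeds it
    exactly when it exceeds every tangent plane, one for each choice of a
    velocity vs and a magnetic field Bs ([admissibleP]).  Up to the constant
    |Bs|^2/2, the excess over a tangent plane is linear in the state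
    ([linear_gap]), and for U with velocity vs + w and magnetic field Bs + b
    it equals rho|w|^2/2 + |b|^2/2 + rho e.

    With l = a dt/dx in ]0, 1], the update of U_j is the convex combination,
    with weights 1 - l and l, of U_j and of the average of
    U_{j+1} - F(U_{j+1})/a and U_{j-1} + F(U_{j-1})/a ([LF_update_convex]), so
    everything rests on the admissibility of that average
    ([admissible_LF_average]).  The gap of either half alone contains terms
    in vs and Bs of no definite sign, which combine only in the sum.

    On a flux, the linear functional takes the value ([linear_gap_flux])

      v_i (rho|w|^2/2 + rho e) + vs_i |b|^2/2
        + (p w_i + (B.b) w_i - B_i (b.w)) + (B_i (vs.Bs) - vs_i |Bs|^2/2).

    The last group depends on the state through B_i only, hence cancels between
    the two fluxes because both states have the same normal field: this is the
    discrete divergence-free condition in one dimension, and the scheme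
    propagates it because the normal magnetic flux vanishes.  The third group
    is a quadratic form in (w, b, e^(1/2)), and C_ p i U is its largest
    eigenvalue relative to the gap ([fast_speed_bound]).  The
    second group contains the free parameter vs_i.  Writing

      vs_i = (s v_i + (1 - s) v'_i) - (s w_i + (1 - s) w'_i),

    the first part is a velocity accounted for in the maximum of alpha_at, and
    the second part multiplies |b|^2 - |b'|^2 = (b - b').(b + b'), where
    b - b' = B - B' does not depend on Bs; Cauchy-Schwarz turns it into the
    jump term of alpha_at ([interface_jump_bound]).  Hence a times the sum of
    the two gaps dominates the difference of the fluxes as soon as a exceeds
    alpha_at for a single s, and the infimum over s provides such an s. *)

(** * The Euclidean structure of R^3 *)

Lemma dotC (R : realType) (u v : 'rV[R]_3) : dot u v = dot v u.
Proof. by apply: eq_bigr => j _; rewrite mulrC. Qed.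

Lemma dotDl (R : realType) (u v w : 'rV[R]_3) :
  dot (u + v) w = dot u w + dot v w.
Proof. by rewrite -big_split; apply: eq_bigr => j _; rewrite mxE mulrDl. Qed.

Lemma dotZl (R : realType) (c : R) (u v : 'rV[R]_3) :
  dot (c *: u) v = c * dot u v.
Proof. by rewrite mulr_sumr; apply: eq_bigr => j _; rewrite mxE mulrA. Qed.

Lemma dotNl (R : realType) (u v : 'rV[R]_3) : dot (- u) v = - dot u v.
Proof. by rewrite -scaleN1r dotZl mulN1r. Qed.

Lemma dotDr (R : realType) (u v w : 'rV[R]_3) :
  dot w (u + v) = dot w u + dot w v.
Proof. by rewrite dotC dotDl !(dotC w). Qed.

Lemma dotZr (R : realType) (c : R) (u v : 'rV[R]_3) :
  dot v (c *: u) = c * dot v u.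
Proof. by rewrite dotC dotZl dotC. Qed.

Lemma dotNr (R : realType) (u v : 'rV[R]_3) : dot v (- u) = - dot v u.
Proof. by rewrite dotC dotNl dotC. Qed.

Lemma dot0l (R : realType) (u : 'rV[R]_3) : dot 0 u = 0.
Proof. by rewrite -(scale0r u) dotZl mul0r. Qed.

Lemma dot_deltal (R : realType) (i : 'I_3) (u : 'rV[R]_3) :
  dot (delta_mx ord0 i) u = u ord0 i.
Proof.
rewrite /dot (bigD1 i) //= big1 ?addr0 => [|j /negPf ji];
  by rewrite mxE ?ji /= ?eqxx ?mul1r ?mul0r.
Qed.

Lemma dot_ge0 (R : realType) (u : 'rV[R]_3) : 0 <= dot u u.
Proof. by apply: sumr_ge0 => j _; rewrite -expr2 sqr_ge0. Qed.

Lemma sqr_enorm (R : realType) (u : 'rV[R]_3) : enorm u ^+ 2 = dot u u.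
Proof. by rewrite sqr_sqrtr ?dot_ge0. Qed.

Lemma enorm_ge0 (R : realType) (u : 'rV[R]_3) : 0 <= enorm u.
Proof. exact: sqrtr_ge0. Qed.

Lemma dot_sqr_le (R : realType) (u v : 'rV[R]_3) :
  dot u v ^+ 2 <= dot u u * dot v v.
Proof.
have [v0|v_gt0] := leP (dot v v) 0.
  have vE : v = 0.
    apply/rowP => j; have := dot_ge0 v; rewrite mxE.
    have /psumr_eq0P/(_ j isT)/eqP : dot v v = 0.
      by apply/eqP; rewrite eq_le v0 dot_ge0.
    rewrite mulf_eq0 orbb => H _; apply/eqP; apply: H => k _.
    by rewrite -expr2 sqr_ge0.
  by rewrite vE dotC !dot0l expr0n mulr0.
have := dot_ge0 (dot v v *: u - dot u v *: v).
rewrite !(dotDl, dotDr, dotNl, dotNr, dotZl, dotZr) (dotC v u).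
set x := dot u u; set y := dot v v in v_gt0 *; set z := dot u v => h.
rewrite -(ler_pM2l v_gt0); nra.
Qed.

(** The normal magnetic perturbation cancels in [fast_speed_bound], which leaves
    the transverse parts of the fields; Cauchy-Schwarz is applied to them
    rather than to the full vectors. *)
Definition transverse (R : realType) (i : 'I_3) (u : 'rV[R]_3) : 'rV[R]_3 :=
  u - u ord0 i *: delta_mx ord0 i.

Lemma dot_transverse (R : realType) (i : 'I_3) (u v : 'rV[R]_3) :
  dot (transverse i u) (transverse i v) = dot u v - u ord0 i * v ord0 i.
Proof.
rewrite /transverse !(dotDl, dotDr, dotNl, dotNr, dotZl, dotZr).
rewrite (dotC u (delta_mx _ _)) !dot_deltal !mxE !eqxx /=; ring.
Qed.

Lemma sqr_coord_le_dot (R : realType) (i : 'I_3) (u : 'rV[R]_3) :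
  u ord0 i ^+ 2 <= dot u u.
Proof. by have := dot_ge0 (transverse i u); rewrite dot_transverse; nra. Qed.

(** * The fast magnetosonic speed *)

Lemma quadratic_form_ge0 (R : realType) (x y c w z : R) :
  0 <= x -> 0 <= y -> c ^+ 2 <= x * y ->
  0 <= x * w ^+ 2 + 2 * c * w * z + y * z ^+ 2.
Proof.
move=> x0 y0 cxy; have [xE|xn0] := eqVneq x 0.
  have -> : c = 0 by apply/eqP; rewrite -sqrf_eq0 eq_le sqr_ge0 andbT;
    move: cxy; rewrite xE mul0r.
  rewrite xE !(mul0r, mulr0, add0r); apply: mulr_ge0 => //; exact: sqr_ge0.
have xp : 0 < x by rewrite lt_def xn0.
rewrite -(pmulr_rge0 _ xp).
have -> : x * (x * w ^+ 2 + 2 * c * w * z + y * z ^+ 2)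
  = (x * w + c * z) ^+ 2 + (x * y - c ^+ 2) * z ^+ 2 by ring.
by rewrite addr_ge0 ?sqr_ge0 // mulr_ge0 ?sqr_ge0 // subr_ge0.
Qed.

(** In terms of s, t and q the square K of the speed is the larger root of
    x^2 - (s + q) x + s t, that is of (x - s) (x - t) = x (q - t).  The
    discriminant is at least (s - t)^2 because t <= q, and so this root
    lies above both s and t. *)
Lemma sqr_C_ (R : realType) (p : R -> R -> R) (i : 'I_3) (U : state R)
    (s := C_s p U ^+ 2) (t := magnetic U ord0 i ^+ 2 / density U)
    (q := dot (magnetic U) (magnetic U) / density U) (K := C_ p i U ^+ 2) :
  0 < density U -> [/\ s <= K, t <= K & (K - s) * (K - t) = K * (q - t)].
Proof.
move=> rho0.
have s0 : 0 <= s by exact: sqr_ge0.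
have t0 : 0 <= t by rewrite mulr_ge0 ?sqr_ge0 // invr_ge0 ltW.
have tq : t <= q by rewrite ler_pM2r ?invr_gt0 // sqr_coord_le_dot.
have disc : (s - t) ^+ 2 <= (s + q) ^+ 2 - 4 * (s * t) by nra.
have disc0 := le_trans (sqr_ge0 _) disc.
set D := (s + q) ^+ 2 - 4 * (s * t) in disc disc0.
have KE : 2 * K = s + q + Num.sqrt D.
  rewrite /K /C_ exprMn exprVn (sqr_sqrtr (ler0n _ 2)) !sqr_enorm -/s -/q.
  rewrite sqr_sqrtr; last by rewrite addr_ge0 ?sqrtr_ge0 // addr_ge0 // (le_trans t0).
  rewrite mulVKf // /D /t; congr (_ + Num.sqrt _); ring.
have D2 : Num.sqrt D ^+ 2 = D by rewrite sqr_sqrtr.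
have : `|s - t| <= Num.sqrt D by rewrite -sqrtr_sqr ler_sqrt.
have r0 := sqrtr_ge0 D.
rewrite ler_norml => /andP[h1 h2]; split; [lra|lra|].
have -> : K = (s + q + Num.sqrt D) / 2 by lra.
apply/eqP; rewrite -subr_eq0; apply/eqP.
transitivity ((Num.sqrt D ^+ 2 - D) / 4); last by rewrite D2 subrr mul0r.
by rewrite /D; field.
Qed.

Section Admissible.
Variables (R : realType) (p : R -> R -> R) (hp : is_eos p).
Variables (U : state R) (hU : admissible U).

Let rho_gt0 : 0 < density U. Proof. by case: hU. Qed.
Let E_gt0 : 0 < internal_energy U. Proof. by case: hU. Qed.

Lemma specific_energy_gt0 : 0 < specific_energy U.
Proof. by rewrite divr_gt0. Qed.

Lemma pressure_gt0 : 0 < pressure p U.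
Proof.
have [+ _] := hp (specific_energy U) rho_gt0; apply.
exact: specific_energy_gt0.
Qed.

Lemma C_s_gt0 : 0 < C_s p U.
Proof.
by rewrite divr_gt0 ?pressure_gt0 // mulr_gt0 // sqrtr_gt0 mulr_gt0 //
  specific_energy_gt0.
Qed.

Lemma sqr_pressure :
  pressure p U ^+ 2 = 2 * internal_energy U * density U * C_s p U ^+ 2.
Proof.
have e0 := specific_energy_gt0.
rewrite /C_s expr_div_n exprMn sqr_sqrtr; last first.
  by rewrite mulr_ge0 // ltW.
rewrite /specific_energy; field.
by rewrite (gt_eqF E_gt0) andbT; exact: lt0r_neq0.
Qed.

Lemma C_gt0 i : 0 < C_ p i U.
Proof.
have [sK _ _] := sqr_C_ p i rho_gt0.
rewrite lt_def mulr_ge0 ?invr_ge0 ?sqrtr_ge0 // andbT.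
apply: contraTneq sK => ->; rewrite expr0n /= -ltNge.
by rewrite exprn_gt0 ?C_s_gt0.
Qed.
End Admissible.

(** * Admissible states as an intersection of half-spaces *)

Lemma densityD (R : realType) (U V : state R) :
  density (U + V) = density U + density V.
Proof. by []. Qed.

Lemma densityZ (R : realType) (c : R) (U : state R) :
  density (c *: U) = c * density U.
Proof. by case: U => [[[? ?] ?] ?]. Qed.

Section EnergyGap.
Variables (R : realType) (vs Bs : 'rV[R]_3).

(** The linear part of the excess of the total energy over the tangent plane of
    |m|^2/(2 rho) + |B|^2/2 at the states of velocity vs and field Bs. *)
Definition linear_gap (U : state R) : R :=
  energy U + density U * dot vs vs / 2
  - dot (momentum U) vs - dot (magnetic U) Bs.

Definition energy_gap (U : state R) : R :=
  linear_gap U + dot Bs Bs / 2.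

Lemma linear_gapD (U V : state R) :
  linear_gap (U + V) = linear_gap U + linear_gap V.
Proof.
rewrite /linear_gap /density /momentum /magnetic /energy /= !dotDl; ring.
Qed.

Lemma linear_gapZ (c : R) (U : state R) :
  linear_gap (c *: U) = c * linear_gap U.
Proof.
rewrite /linear_gap /density /momentum /magnetic /energy /= !dotZl.
rewrite /GRing.scale /=; ring.
Qed.

Lemma linear_gapN (U : state R) :
  linear_gap (- U) = - linear_gap U.
Proof. by rewrite -scaleN1r linear_gapZ mulN1r. Qed.

(** Each of the two convex energies exceeds its tangent plane by a square. *)
Lemma energy_gapE (U : state R) (w := velocity U - vs) (b := magnetic U - Bs) :
  density U != 0 ->
  energy_gap U = density U * dot w w / 2 + dot b b / 2 + internal_energy U.
Proof.
move=> rho0; have mE : momentum U = density U *: velocity U.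
  by rewrite /velocity scalerA mulfV // scale1r.
rewrite /energy_gap /linear_gap /internal_energy !sqr_enorm mE.
rewrite !(dotDl, dotDr, dotNl, dotNr, dotZl, dotZr).
rewrite (dotC vs) (dotC Bs (magnetic U)); field; exact: rho0.
Qed.

(** The grouping is by the estimate each part receives: the convective terms,
    the term in the free velocity vs, the terms controlled by the fast speed,
    and those that depend on the state only through its normal field.  The
    coefficient of |b|^2/2 is vs_i rather than v_i because the magnetic pressure
    |B|^2/2 = B.b - |b|^2/2 + |Bs|^2/2, multiplied by w_i, removes w_i |b|^2/2
    from the convected v_i |b|^2/2. *)
Lemma linear_gap_flux (p : R -> R -> R) (i : 'I_3) (U : state R)
    (v := velocity U) (B := magnetic U) (w := v - vs) (b := B - Bs) :
  density U != 0 ->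
  linear_gap (flux p i U) =
    v ord0 i * (density U * dot w w / 2 + internal_energy U)
    + vs ord0 i * (dot b b / 2)
    + (pressure p U * w ord0 i + dot B b * w ord0 i - B ord0 i * dot b w)
    + (B ord0 i * dot vs Bs - vs ord0 i * (dot Bs Bs / 2)).
Proof.
move=> rho0; have mE : momentum U = density U *: v.
  by rewrite /v /velocity scalerA mulfV // scale1r.
have EE : energy U = internal_energy U
    + (density U * dot v v + dot B B) / 2.
  rewrite /internal_energy !sqr_enorm mE -/B !(dotZl, dotZr); field; exact: rho0.
rewrite /flux -/v -/B EE /total_pressure sqr_enorm -/B /w /b.
clearbody v B; rewrite /linear_gap /mkstate /density /momentum /magnetic /energy /=.
rewrite !(dotDl, dotDr, dotNl, dotNr, dotZl, dotZr) dot_deltal !mxE.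
rewrite (dotC vs) (dotC Bs B) (dotC B v) (dotC Bs vs) (dotC Bs v) (dotC B vs).
by field.
Qed.
End EnergyGap.

(** The gap at the velocity and the magnetic field of U itself is exactly the
    internal energy of U. *)
Lemma admissibleP (R : realType) (U : state R) :
  admissible U <->
    0 < density U /\ forall vs Bs, 0 < energy_gap vs Bs U.
Proof.
split=> -[rho0 E0]; split=> //.
  move=> vs Bs; rewrite energy_gapE ?gt_eqF // ltr_wpDl //.
  by rewrite addr_ge0 // mulr_ge0 ?invr_ge0 ?ler0n ?dot_ge0 // mulr_ge0 ?dot_ge0
    // ltW.
have := E0 (velocity U) (magnetic U); rewrite energy_gapE ?gt_eqF //.
by rewrite !subrr !dot0l !(mul0r, mulr0, add0r).
Qed.

(** The form on the left is an indefinite quadratic form in the perturbations,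
    whose largest eigenvalue relative to the gap is the fast speed C.  The
    normal magnetic perturbation cancels on the left.  The difference of the
    two sides, times 2 C, is (C b_i)^2 plus three nonnegative forms: one couples the
    transverse parts of w and b, one couples w_i with the transverse field, and
    one couples w_i with the internal energy.  The second is nonnegative by
    the characteristic equation of C (see [sqr_C_]). *)
Lemma fast_speed_bound (R : realType) (p : R -> R -> R) (i : 'I_3)
    (U : state R) (w b : 'rV[R]_3) (B := magnetic U) :
  is_eos p -> admissible U ->
  `|pressure p U * w ord0 i + dot B b * w ord0 i - B ord0 i * dot b w|
    <= C_ p i U
       * (density U * dot w w / 2 + dot b b / 2 + internal_energy U).
Proof.
move=> hp hU; wlog suff main : w /
    pressure p U * w ord0 i + dot B b * w ord0 i - B ord0 i * dot b w
      <= C_ p i U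
       * (density U * dot w w / 2 + dot b b / 2 + internal_energy U).
  rewrite ler_norml main andbT lerNl.
  by have := main (- w); rewrite dotNl !dotNr opprK mxE; lra.
have [rho0 E0] := hU; have C0 := C_gt0 hp hU i.
have [sK tK KE] := sqr_C_ p i rho0.
have p2 := sqr_pressure p hU.
have W0 := dot_ge0 (transverse i w); have N0 := dot_ge0 (transverse i b).
have := dot_sqr_le (transverse i b) (transverse i w).
have := dot_sqr_le (transverse i B) (transverse i b).
move: W0 N0; rewrite !dot_transverse.
have EQ : dot B B - B ord0 i * B ord0 i = density U *
  (dot B B / density U - B ord0 i ^+ 2 / density U).
  by field; rewrite gt_eqF.
rewrite EQ.
have EB : B ord0 i ^+ 2 = density U * (B ord0 i ^+ 2 / density U).
  by field; rewrite gt_eqF.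
rewrite -/B in KE tK *.
have t0 : 0 <= B ord0 i ^+ 2 / density U by rewrite mulr_ge0 ?sqr_ge0 // invr_ge0 ltW.
move: (B ord0 i ^+ 2 / density U) (dot B B / density U) EQ EB KE tK t0 => t q _ EB KE tK t0.
set C := C_ p i U in C0 sK tK KE *; set rho := density U in rho0 p2 EB *.
set E := internal_energy U in E0 p2 *; set pr := pressure p U in p2 *.
set s := C_s p U ^+ 2 in sK KE p2.
set Bi := B ord0 i in EB *; set wi := w ord0 i; set bi := b ord0 i.
set W := dot w w - wi * wi; set N := dot b b - bi * bi.
have -> : dot w w = W + wi ^+ 2 by rewrite /W; ring.
have -> : dot b b = N + bi ^+ 2 by rewrite /N; ring.
set P := dot B b - Bi * bi.
have -> : dot B b = P + Bi * bi by rewrite /P; ring.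
set M := dot b w - bi * wi.
have -> : dot b w = M + bi * wi by rewrite /M; ring.
move=> W0 N0 P2 M2; clearbody W N P M.
(* The transverse vectors enter through M, bounded by M^2 <= N W, so the form is
   taken at the point (1, 1) with W and N inside its coefficients. *)
have f1 : 0 <= rho * C ^+ 2 * W * 1 ^+ 2 + 2 * (C * Bi * M) * 1 * 1 + t * N * 1 ^+ 2.
  apply: quadratic_form_ge0; [|exact: mulr_ge0|].
    by rewrite !mulr_ge0 ?sqr_ge0 // ltW.
  have -> : rho * C ^+ 2 * W * (t * N) = C ^+ 2 * Bi ^+ 2 * (N * W).
    by rewrite EB; ring.
  by rewrite !exprMn ler_wpM2l // mulr_ge0 ?sqr_ge0.
(* The determinant condition of this form is the characteristic equation KE. *)
have f2 : 0 <= rho * (C ^+ 2 - s) * wi ^+ 2 + 2 * (- (C * P)) * wi * 1 + (C ^+ 2 - t) * N * 1 ^+ 2.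
  apply: quadratic_form_ge0.
  - by rewrite mulr_ge0 ?subr_ge0 // ltW.
  - by rewrite mulr_ge0 ?subr_ge0.
  - have -> : rho * (C ^+ 2 - s) * ((C ^+ 2 - t) * N) = C ^+ 2 * (rho * (q - t) * N).
      by rewrite mulrA -(mulrA rho) KE; ring.
    by rewrite sqrrN exprMn ler_pM2l ?exprn_gt0.
(* A perfect square up to a factor, since pr^2 = 2 E rho s by definition of
   the speed C_s. *)
have f3 : 0 <= 2 * E * C ^+ 2 - 2 * C * pr * wi + rho * s * wi ^+ 2.
  have E2 : 0 < 2 * E by lra.
  rewrite -(pmulr_rge0 _ E2).
  have -> : 2 * E * (2 * E * C ^+ 2 - 2 * C * pr * wi + rho * s * wi ^+ 2)
     = (2 * E * C - pr * wi) ^+ 2 + (2 * E * rho * s - pr ^+ 2) * wi ^+ 2 by ring.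
  by rewrite p2 subrr mul0r addr0 sqr_ge0.
have C2 : 0 < 2 * C by lra.
rewrite -(ler_pM2l C2) -subr_ge0.
have -> : 2 * C * (C * (rho * (W + wi ^+ 2) / 2 + (N + bi ^+ 2) / 2 + E)) -
  2 * C * (pr * wi + (P + Bi * bi) * wi - Bi * (M + bi * wi))
  = (rho * C ^+ 2 * W * 1 ^+ 2 + 2 * (C * Bi * M) * 1 * 1 + t * N * 1 ^+ 2)
  + (rho * (C ^+ 2 - s) * wi ^+ 2 + 2 * (- (C * P)) * wi * 1 + (C ^+ 2 - t) * N * 1 ^+ 2)
  + (2 * E * C ^+ 2 - 2 * C * pr * wi + rho * s * wi ^+ 2) + C ^+ 2 * bi ^+ 2 by field.
by apply: addr_ge0 (addr_ge0 (addr_ge0 f1 f2) f3) _; rewrite mulr_ge0 ?sqr_ge0.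
Qed.

(** * Positivity of the Lax-Friedrichs average *)

(** The difference of squares factors as (b - b').(b + b').  The factor b - b'
    is the jump of the field, while |b + b'|^2 <= 2 (|b|^2 + |b'|^2); the
    combination of w and w' is bounded by Cauchy-Schwarz with weights rho and
    rho'.  The geometric mean of the kinetic and magnetic sums is then at most
    their arithmetic mean. *)
Lemma interface_jump_bound (R : realType) (s rho rho' w w' : R)
    (b b' : 'rV[R]_3) :
  0 < rho -> 0 < rho' ->
  `|(s * w + (1 - s) * w') * ((dot b b - dot b' b') / 2)|
    <= enorm (b' - b) / Num.sqrt 2
       * Num.sqrt (s ^+ 2 / rho + (1 - s) ^+ 2 / rho')
       * (rho * w ^+ 2 / 2 + dot b b / 2 + (rho' * w' ^+ 2 / 2 + dot b' b' / 2)).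
Proof.
move=> rho0 rho'0; set S := s ^+ 2 / rho + (1 - s) ^+ 2 / rho'.
have S0 : 0 <= S.
  by rewrite addr_ge0 // mulr_ge0 ?sqr_ge0 // invr_ge0 ltW.
have w_le : (s * w + (1 - s) * w') ^+ 2
    <= S * (rho * w ^+ 2 + rho' * w' ^+ 2).
  rewrite -subr_ge0.
  have -> : S * (rho * w ^+ 2 + rho' * w' ^+ 2) - (s * w + (1 - s) * w') ^+ 2
      = (s * rho' * w' - (1 - s) * rho * w) ^+ 2 / (rho * rho').
    by rewrite /S; field; rewrite !gt_eqF.
  by rewrite mulr_ge0 ?sqr_ge0 // invr_ge0 mulr_ge0 // ltW.
have b_le : (dot b b - dot b' b') ^+ 2
    <= dot (b' - b) (b' - b) * (2 * (dot b b + dot b' b')).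
  have := dot_sqr_le (b' - b) (b + b').
  have := dot_ge0 (b' - b); have := mulr_ge0 (dot_ge0 (b' - b)) (dot_ge0 (b' - b)).
  rewrite !(dotDl, dotDr, dotNl, dotNr) (dotC b' b); nra.
have X0 : 0 <= rho * w ^+ 2 + rho' * w' ^+ 2.
  by rewrite addr_ge0 // mulr_ge0 ?sqr_ge0 // ltW.
have Y0 : 0 <= dot b b + dot b' b' by rewrite addr_ge0 ?dot_ge0.
have D0 := dot_ge0 (b' - b).
have -> : rho * w ^+ 2 / 2 + dot b b / 2 + (rho' * w' ^+ 2 / 2 + dot b' b' / 2)
  = ((rho * w ^+ 2 + rho' * w' ^+ 2) + (dot b b + dot b' b')) / 2 by field.
move: (s * w + (1 - s) * w') w_le b_le X0 Y0 D0 => z.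
move: (rho * w ^+ 2 + rho' * w' ^+ 2) (dot b b + dot b' b') => X Y.
move: (dot b b - dot b' b') (dot (b' - b) (b' - b)) (sqr_enorm (b' - b)) (enorm_ge0 (b' - b)) => d D.
move: (enorm _) => e eD e0 z_le d_le X0 Y0 D0.
have R0 : 0 <= e / Num.sqrt 2 * Num.sqrt S * ((X + Y) / 2).
  by rewrite !mulr_ge0 ?invr_ge0 ?sqrtr_ge0 // addr_ge0.
rewrite -(ger0_norm R0) -ler_sqr ?nnegrE // !real_normK ?num_real //.
have -> : (e / Num.sqrt 2 * Num.sqrt S * ((X + Y) / 2)) ^+ 2
   = e ^+ 2 * (Num.sqrt 2 ^+ 2)^-1 * Num.sqrt S ^+ 2 * (X + Y) ^+ 2 / 4.
   by rewrite !exprMn !exprVn; field.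
rewrite !sqr_sqrtr // eD.
have h : z ^+ 2 * d ^+ 2 <= S * X * (D * (2 * Y)) by rewrite ler_pM ?sqr_ge0.
have k : 0 <= S * D * (X - Y) ^+ 2 by exact: mulr_ge0 (mulr_ge0 S0 D0) (sqr_ge0 _).
lra.
Qed.

(** This is 2 a times the gap of the Lax-Friedrichs average: the two constants
    |Bs|^2/2 hidden in the gaps add up to twice the one required. *)
Lemma linear_gap_LF_pair (R : realType) (p : R -> R -> R) (i : 'I_3)
    (U U' : state R) (a s : R) (vs Bs : 'rV[R]_3) :
  is_eos p -> admissible U -> admissible U' ->
  magnetic U ord0 i = magnetic U' ord0 i -> alpha_at p i U U' s < a ->
  0 < a * (energy_gap vs Bs U + energy_gap vs Bs U')
      + (linear_gap vs Bs (flux p i U') - linear_gap vs Bs (flux p i U)).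
Proof.
move=> hp hU hU' eqB; have [rho0 E0] := hU; have [rho'0 E'0] := hU'.
have rhoN := lt0r_neq0 rho0; have rho'N := lt0r_neq0 rho'0.
rewrite !energy_gapE // !linear_gap_flux // -eqB.
set w := velocity U - vs; set w' := velocity U' - vs.
set b := magnetic U - Bs; set b' := magnetic U' - Bs.
have := interface_jump_bound s (w ord0 i) (w' ord0 i) b b' rho0 rho'0.
have := fast_speed_bound i w b hp hU.
have := fast_speed_bound i w' b' hp hU'; rewrite -eqB.
have -> : b' - b = magnetic U' - magnetic U.
  by rewrite /b' /b opprB addrA subrK.
rewrite /alpha_at.
(* The free velocity is split so that its unbounded part is carried by the
   perturbations w and w', which the gaps control. *)
have vsE : vs ord0 i = s * velocity U ord0 i + (1 - s) * velocity U' ord0 i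
    - (s * w ord0 i + (1 - s) * w' ord0 i) by rewrite /w /w' !mxE; ring.
rewrite vsE.
have kin (r : R) (z : 'rV[R]_3) : 0 < r -> r * z ord0 i ^+ 2 / 2 <= r * dot z z / 2.
  by move=> r0; rewrite ler_pM2r ?invr_gt0 // ler_pM2l // sqr_coord_le_dot.
have wle := kin _ w rho0; have w'le := kin _ w' rho'0.
have W0 : 0 <= density U * dot w w / 2.
  by rewrite mulr_ge0 ?invr_ge0 ?ler0n // mulr_ge0 ?dot_ge0 // ltW.
have W'0 : 0 <= density U' * dot w' w' / 2.
  by rewrite mulr_ge0 ?invr_ge0 ?ler0n // mulr_ge0 ?dot_ge0 // ltW.
have b0 : 0 <= dot b b / 2 by rewrite mulr_ge0 ?invr_ge0 ?dot_ge0.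
have b'0 : 0 <= dot b' b' / 2 by rewrite mulr_ge0 ?invr_ge0 ?dot_ge0.
have T0 : 0 <= enorm (magnetic U' - magnetic U) / Num.sqrt 2 *
     Num.sqrt (s ^+ 2 / density U + (1 - s) ^+ 2 / density U').
  by rewrite !mulr_ge0 ?invr_ge0 ?sqrtr_ge0.
move: T0; set T := _ * Num.sqrt (_ + _) => T0.
set V := s * velocity U ord0 i + (1 - s) * velocity U' ord0 i.
set z := s * w ord0 i + (1 - s) * w' ord0 i.
set M := Num.max _ _ => G'le Gle zle aM.
have M1 : `|velocity U ord0 i| + C_ p i U <= M by rewrite /M le_max lexx.
have M2 : `|velocity U' ord0 i| + C_ p i U' <= M by rewrite /M !le_max lexx orbT.
have M3 : `|V| + C_ p i U <= M.
  by rewrite /M !le_max lerD2l le_max lexx !orbT.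
have M4 : `|V| + C_ p i U' <= M.
  by rewrite /M !le_max lerD2l le_max lexx !orbT.
clearbody M T V z.
have {}zle : `|z * (dot b b / 2 - dot b' b' / 2)| <=
    T * (density U * dot w w / 2 + dot b b / 2 + internal_energy U
         + (density U' * dot w' w' / 2 + dot b' b' / 2 + internal_energy U')).
  by rewrite -mulrBl; apply: le_trans zle _; rewrite ler_wpM2l //; lra.
move: Gle G'le zle W0 W'0 b0 b'0 M1 M2.
set G := _ + _ - magnetic U ord0 i * dot b w.
set G' := _ + _ - magnetic U ord0 i * dot b' w'.
move: (velocity U ord0 i) (velocity U' ord0 i) => v v'.
move: (C_ p i U) (C_ p i U') M3 M4 => C C' M3 M4.
move: (density U * dot w w / 2) (density U' * dot w' w' / 2) => k k'.
move: (dot b b / 2) (dot b' b' / 2) => m m'.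
move: (internal_energy U) (internal_energy U') E0 E'0 => E E' E0 E'0.
move: (magnetic U ord0 i * dot vs Bs) (dot Bs Bs / 2) G G' => c d G G'.
rewrite !ler_norml => /andP[_ Gle] /andP[G'le _] /andP[zle _] k0 k'0 m0 m'0 M1 M2.
have A0 : 0 <= k + E by lra.
have A'0 : 0 <= k' + E' by lra.
have vA : v * (k + E) <= `|v| * (k + E) by rewrite ler_wpM2r // ler_norm.
have v'A' : - (v' * (k' + E')) <= `|v'| * (k' + E').
  by rewrite -mulNr ler_wpM2r // -normrN ler_norm.
have Vm : V * m <= `|V| * m by rewrite ler_wpM2r // ler_norm.
have Vm' : - (V * m') <= `|V| * m' by rewrite -mulNr ler_wpM2r // -normrN ler_norm.
have := ler_wpM2r A0 M1; have := ler_wpM2r A'0 M2.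
have := ler_wpM2r m0 M3; have := ler_wpM2r m'0 M4.
have H0 : 0 < k + m + E + (k' + m' + E') by lra.
have := aM; rewrite -(ltr_pM2r H0).
lra.
Qed.

(** The resulting bound |v_i| < a keeps the density of each half of the
    Lax-Friedrichs average positive. *)
Lemma velocity_lt_alpha_at (R : realType) (p : R -> R -> R) (i : 'I_3)
    (U U' : state R) (s : R) :
  is_eos p -> admissible U -> admissible U' ->
  `|velocity U ord0 i| < alpha_at p i U U' s
  /\ `|velocity U' ord0 i| < alpha_at p i U U' s.
Proof.
move=> hp hU hU'; have C0 := C_gt0 hp hU i; have C'0 := C_gt0 hp hU' i.
have T0 : 0 <= enorm (magnetic U' - magnetic U) / Num.sqrt 2 *
     Num.sqrt (s ^+ 2 / density U + (1 - s) ^+ 2 / density U').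
  by rewrite !mulr_ge0 ?invr_ge0 ?sqrtr_ge0.
split; apply: ltr_wpDr => //.
  by rewrite lt_max ltrDl C0.
by rewrite !lt_max ltrDl C'0 orbT.
Qed.

Lemma admissible_LF_average (R : realType) (p : R -> R -> R) (i : 'I_3)
    (U U' : state R) (a : R) :
  is_eos p -> admissible U -> admissible U' ->
  magnetic U ord0 i = magnetic U' ord0 i -> alpha p i U U' < a ->
  0 < a /\
  admissible (2^-1 *: ((U - a^-1 *: flux p i U) + (U' + a^-1 *: flux p i U'))).
Proof.
move=> hp hU hU' eqB alpha_a.
(* A single parameter s below a suffices; it need not attain the infimum. *)
have [_ [s _ <-] sa] : exists2 y, range (alpha_at p i U U') y & y < a.
  by apply: inf_lt alpha_a; exists (alpha_at p i U U' 0); exists 0.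
have [v_s v'_s] := velocity_lt_alpha_at i s hp hU hU'.
have va := lt_trans v_s sa; have v'a := lt_trans v'_s sa.
have a0 : 0 < a by apply: le_lt_trans va.
split=> //; apply/admissibleP; split.
  have [rho0 _] := hU; have [rho'0 _] := hU'.
  have -> : density (2^-1 *: ((U - a^-1 *: flux p i U) + (U' + a^-1 *: flux p i U')))
    = (density U * (a - velocity U ord0 i)
       + density U' * (a + velocity U' ord0 i)) / (2 * a).
    transitivity (2^-1 * ((density U - a^-1 * (density U * velocity U ord0 i))
      + (density U' + a^-1 * (density U' * velocity U' ord0 i)))) => //.
    move: (density U) (density U') (velocity U ord0 i) (velocity U' ord0 i) => *.
    by field; rewrite gt_eqF.
  move: va v'a; rewrite !ltr_norml => /andP[_ va] /andP[v'a _].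
  by rewrite divr_gt0 ?mulr_gt0 // addr_gt0 // mulr_gt0 //; lra.
move=> vs Bs; have := linear_gap_LF_pair vs Bs hp hU hU' eqB sa.
rewrite /energy_gap !(linear_gapZ, linear_gapD, linear_gapN).
have a2 : 0 < (2 * a)^-1 by rewrite invr_gt0 mulr_gt0.
rewrite -(ltr_pM2l a2) mulr0 => /lt_le_trans; apply.
rewrite le_eqVlt; apply/orP; left; apply/eqP; field; exact: lt0r_neq0.
Qed.

(** * The scheme as a convex combination *)

Lemma admissible_convex (R : realType) (U V : state R) (l : R) :
  admissible U -> admissible V -> 0 < l <= 1 ->
  admissible ((1 - l) *: U + l *: V).
Proof.
move=> /admissibleP[rU gU] /admissibleP[rV gV] /andP[l0 l1].
have conv (x y : R) : 0 < x -> 0 < y -> 0 < (1 - l) * x + l * y.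
  by move=> x0 y0; rewrite ltr_wpDl ?mulr_gt0 // mulr_ge0 ?subr_ge0 // ltW.
apply/admissibleP; split; first by rewrite densityD !densityZ; exact: conv.
move=> vs Bs; have := conv _ _ (gU vs Bs) (gV vs Bs).
rewrite /energy_gap linear_gapD !linear_gapZ; lra.
Qed.

(** The flux F of the updated cell cancels: it enters the numerical fluxes
    through both of its interfaces with the same coefficient. *)
Lemma LF_update_convex (R : realType) (U Up Um F Fp Fm : state R)
    (a k : R) : a != 0 ->
  U - k *: (2^-1 *: (F + Fp - a *: (Up - U)) - 2^-1 *: (Fm + F - a *: (U - Um)))
  = (1 - a * k) *: U
    + (a * k) *: (2^-1 *: ((Up - a^-1 *: Fp) + (Um + a^-1 *: Fm))).
Proof.
move=> a0; have eqR (u up um f fp fm : R) :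
    u - k * (2^-1 * (f + fp - a * (up - u)) - 2^-1 * (fm + f - a * (u - um)))
    = (1 - a * k) * u
      + (a * k) * (2^-1 * ((up - a^-1 * fp) + (um + a^-1 * fm))) by field.
case: U Up Um F Fp Fm => [[[? ?] ?] ?] [[[? ?] ?] ?] [[[? ?] ?] ?]
  [[[? ?] ?] ?] [[[? ?] ?] ?] [[[? ?] ?] ?].
by congr (_, _, _, _); rewrite ?eqR //; apply/rowP => j; rewrite !mxE eqR.
Qed.

(** Keeps the normal field constant in time, as the cancellation between the
    two fluxes requires at every step. *)
Lemma magnetic_flux_normal (R : realType) (p : R -> R -> R) (i : 'I_3)
    (U : state R) : magnetic (flux p i U) ord0 i = 0.
Proof. by rewrite /flux /magnetic /= !mxE mulrC subrr. Qed.

Theorem theorem3p2 (R : realType) (p : R -> R -> R) (dx Bconst : R)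
  (dt a : nat -> R) (U : nat -> int -> state R)
  (hp : is_eos p) (hdx : 0 < dx)
  (hscheme : LF_scheme p dx dt a U)
  (hU0 : forall j : int, admissible (U 0%N j))
  (hB0 : forall j : int, magnetic (U 0%N j) ord0 ord0 = Bconst)
  (ha : forall n : nat,
    (ereal_sup (range (fun j : int =>
        (alpha p ord0 (U n (j + 1)%R) (U n (j - 1)%R))%:E)) < (a n)%:E)%E)
  (hcfl : forall n : nat, 0 < a n * dt n / dx <= 1) :
  forall (n : nat) (j : int),
    admissible (U n j) /\ magnetic (U n j) ord0 ord0 = Bconst.
Proof.
elim=> [|n IH] j; first by split; [exact: hU0|exact: hB0].
have [hU hB] := IH j; have [hUp hBp] := IH (j + 1); have [hUm hBm] := IH (j - 1).
have alpha_a : alpha p ord0 (U n (j + 1)) (U n (j - 1)) < a n.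
  rewrite -lte_fin; apply: le_lt_trans (ha n).
  by apply: ereal_sup_ubound; exists j.
have [a0 hW] := admissible_LF_average hp hUp hUm (etrans hBp (esym hBm)) alpha_a.
rewrite hscheme /LF_flux LF_update_convex ?lt0r_neq0 // mulrA; split.
  exact: admissible_convex hU hW (hcfl n).
set l := _ / dx; have magnE V W : magnetic (V + W) ord0 ord0
    = magnetic V ord0 ord0 + magnetic W ord0 ord0 :> R by rewrite mxE.
have magnZ c V : magnetic (c *: V) ord0 ord0 = c * magnetic V ord0 ord0 :> R.
  by rewrite mxE.
have magnN V : magnetic (- V) ord0 ord0 = - magnetic V ord0 ord0 :> R.
  by rewrite mxE.
rewrite !(magnE, magnN, magnZ) !magnetic_flux_normal hB hBp hBm; clearbody l; field.
by rewrite lt0r_neq0.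
Qed.
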